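(* Let $\{(\hat s_i,\hat x_i)\}_{i=1}^N$ be a dataset with $\hat x_i\in\mathbb{X}(\hat s_i)$, let $\phi:\mathbb{S}\times\mathbb{X}\to\mathbb{R}^p$ be a feature mapping that is not trivially zero, and let $$\mathbb{C} := \big\{\theta\in\mathbb{R}^p : \langle\theta,\phi(\hat s_i,\hat x_i)-\phi(\hat s_i,x_i)\rangle\le 0,\ \forall x_i\in\mathbb{X}(\hat s_i),\ \forall i\in[N]\big\}.$$ Assume $\operatorname{int}(\mathbb{C})\neq\emptyset$. Then the problem $$\begin{aligned}\max_{\theta\in\mathbb{R}^p,\,r\in\mathbb{R}}\quad & r\\ \text{s.t.}\quad & \langle\theta,\phi(\hat s_i,\hat x_i)-\phi(\hat s_i,x_i)\rangle + r\,\|\phi(\hat s_i,x_i)-\phi(\hat s_i,\hat x_i)\|_2\le 0\quad\forall x_i\in\mathbb{X}(\hat s_i),\ \forall i\in[N]\\ & \|\theta\|_2=1\end{aligned}\tag{P}$$ can be solved as $$\begin{aligned}\bar\theta^{\mathrm{in}}\in\operatorname*{argmin}_{\theta\in\mathbb{R}^p}\quad & \|\theta\|_2\\ \text{s.t.}\quad & \langle\theta,\phi(\hat s_i,\hat x_i)-\phi(\hat s_i,x_i)\rangle + \|\phi(\hat s_i,x_i)-\phi(\hat s_i,\hat x_i)\|_2\le 0\quad\forall x_i\in\mathbb{X}(\hat s_i),\ \forall i\in[N],\end{aligned}$$ where $\theta^{\mathrm{in}}=\bar\theta^{\mathrm{in}}/\|\bar\theta^{\mathrm{in}}\|_2$ is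 an optimal solution of (P) (that is, it is the $\theta$-component of an optimal pair $(\theta,r)$ of (P)).
   Context: $\mathbb{S}$ is a set of signals; for each $s\in\mathbb{S}$, $\mathbb{X}(s)$ is the feasible set and $\mathbb{X}:=\bigcup_{s\in\mathbb{S}}\mathbb{X}(s)$. $[N]=\{1,\dots,N\}$; $\operatorname{int}(\mathbb{C})$ denotes the interior of $\mathbb{C}$. The feature mapping being ''not trivially zero'' means that $\phi(s,\cdot)$ is not identically zero on $\mathbb{X}(s)$ for the signals under consideration.
   Formalization: Adds the hypothesis that some feature difference φ(ŝ_i,x)−φ(ŝ_i,x̂_i) with x in X(ŝ_i) is nonzero; otherwise (e.g. φ a nonzero constant) problem (P) is unbounded and the minimum-norm solution is 0, which cannot be normalized. *)

(* Defs.v *)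
From HB Require Import structures.
From mathcomp Require Import all_boot all_order all_algebra.
From mathcomp Require Import all_classical all_reals all_analysis.

Set Implicit Arguments.
Unset Strict Implicit.
Unset Printing Implicit Defensive.

Import Order.TTheory GRing.Theory Num.Theory.
Import numFieldNormedType.Exports.

Local Open Scope classical_set_scope.
Local Open Scope ring_scope.

Definition dot (R : realType) (p : nat) (u v : 'rV[R]_p) : R :=
  \sum_(j < p) u ord0 j * v ord0 j.

(* The library norm `|u| on 'rV[R]_p is the sup norm, hence this definition. *)
Definition norm2 (R : realType) (p : nat) (u : 'rV[R]_p) : R :=
  Num.sqrt (dot u u).

Definition argmin (R : realType) (T : Type) (F : set T) (f : T -> R) : set T :=
  [set x | F x /\ forall y, F y -> f x <= f y].

Definition argmax (R : realType) (T : Type) (F : set T) (f : T -> R) : set T :=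
  [set x | F x /\ forall y, F y -> f y <= f x].

(* Below, S is the set of signals, X s the feasible set of the signal s inside
   an ambient type T, and (shat i, xhat i), i : 'I_N, the dataset.  The feature
   mapping phi is total on T, but phi s is only evaluated at points of X s. *)

Definition consistent_cone (R : realType) (S T : Type) (X : S -> set T)
    (p : nat) (phi : S -> T -> 'rV[R]_p)
    (N : nat) (shat : 'I_N -> S) (xhat : 'I_N -> T) : set 'rV[R]_p :=
  [set theta | forall (i : 'I_N) (x : T), X (shat i) x ->
     dot theta (phi (shat i) (xhat i) - phi (shat i) x) <= 0].

Definition incenter_feasible (R : realType) (S T : Type) (X : S -> set T)
    (p : nat) (phi : S -> T -> 'rV[R]_p)
    (N : nat) (shat : 'I_N -> S) (xhat : 'I_N -> T) : set ('rV[R]_p * R) :=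
  [set tr | (forall (i : 'I_N) (x : T), X (shat i) x ->
       dot tr.1 (phi (shat i) (xhat i) - phi (shat i) x)
         + tr.2 * norm2 (phi (shat i) x - phi (shat i) (xhat i)) <= 0)
     /\ norm2 tr.1 = 1].

Definition incenter_solution (R : realType) (S T : Type) (X : S -> set T)
    (p : nat) (phi : S -> T -> 'rV[R]_p)
    (N : nat) (shat : 'I_N -> S) (xhat : 'I_N -> T) : set ('rV[R]_p * R) :=
  argmax (incenter_feasible X phi shat xhat) snd.

Definition min_norm_feasible (R : realType) (S T : Type) (X : S -> set T)
    (p : nat) (phi : S -> T -> 'rV[R]_p)
    (N : nat) (shat : 'I_N -> S) (xhat : 'I_N -> T) : set 'rV[R]_p :=
  [set theta | forall (i : 'I_N) (x : T), X (shat i) x ->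
     dot theta (phi (shat i) (xhat i) - phi (shat i) x)
       + norm2 (phi (shat i) x - phi (shat i) (xhat i)) <= 0].

Definition min_norm_solution (R : realType) (S T : Type) (X : S -> set T)
    (p : nat) (phi : S -> T -> 'rV[R]_p)
    (N : nat) (shat : 'I_N -> S) (xhat : 'I_N -> T) : set 'rV[R]_p :=
  argmin (min_norm_feasible X phi shat xhat) (@norm2 R p).

Definition feature_not_trivially_zero (R : realType) (S T : Type)
    (X : S -> set T) (p : nat) (phi : S -> T -> 'rV[R]_p)
    (N : nat) (shat : 'I_N -> S) : Prop :=
  forall i : 'I_N, exists2 x, X (shat i) x & phi (shat i) x <> 0.

(* Not implied by [feature_not_trivially_zero].  Without it (for instance when
   phi is a nonzero constant) every constraint reads 0 <= 0: the second
   component r of the incenter problem is unbounded, and the minimum-norm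
   problem is solved by 0, which cannot be normalized. *)
Definition feature_separating (R : realType) (S T : Type)
    (X : S -> set T) (p : nat) (phi : S -> T -> 'rV[R]_p)
    (N : nat) (shat : 'I_N -> S) (xhat : 'I_N -> T) : Prop :=
  exists (i : 'I_N) (x : T),
    X (shat i) x /\ phi (shat i) x <> phi (shat i) (xhat i).

(* Main.v *)
Require Import Defs.
From mathcomp Require Import all_boot all_order all_algebra.
From mathcomp Require Import all_classical all_reals all_analysis.

Import Order.TTheory GRing.Theory Num.Theory.
Import numFieldNormedType.Exports.

Local Open Scope classical_set_scope.
Local Open Scope ring_scope.

(** The incenter problem is homogeneous: for r > 0, dividing its inequality
    constraints by r turns (theta, r) into the vector theta / r, which satisfies
    the constraints of the minimum-norm problem, and the condition
    norm2 theta = 1 becomes norm2 (theta / r) = 1 / r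
    ([incenter_feasibleE]).  Maximizing r is thus minimizing the norm of
    theta / r, and a minimizer u yields the optimal pair
    (u / norm2 u, 1 / norm2 u).  Pairs with r <= 0 cannot compete with it, and
    the division by norm2 u is legitimate because a constraint whose two
    features differ excludes u = 0 ([min_norm_feasible_norm2_gt0]).

    A minimizer exists because the feasible set is closed
    ([min_norm_feasible_closed]), nonempty ([min_norm_feasible_nonempty]), and
    norm2 is continuous with bounded sublevel sets ([closed_argmin_norm2]).
    Nonemptiness is where the interior of the cone is used: if a ball around u
    lies in the cone, then u can be pushed by a fixed amount t towards the
    normal of each constraint, so u satisfies each of them with a margin
    proportional to the length of that normal, and u / t is feasible. *)

Lemma dotZl (R : realType) (p : nat) (a : R) (u v : 'rV[R]_p) :
  dot (a *: u) v = a * dot u v.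
Proof. by rewrite /dot mulr_sumr; apply: eq_bigr => j _; rewrite mxE mulrA. Qed.

Lemma dotZr (R : realType) (p : nat) (a : R) (u v : 'rV[R]_p) :
  dot u (a *: v) = a * dot u v.
Proof. by rewrite /dot mulr_sumr; apply: eq_bigr => j _; rewrite mxE mulrCA. Qed.

Lemma dotDl (R : realType) (p : nat) (u v w : 'rV[R]_p) :
  dot (u + v) w = dot u w + dot v w.
Proof. by rewrite /dot -big_split; apply: eq_bigr => j _; rewrite mxE mulrDl. Qed.

Lemma dot_ge0 (R : realType) (p : nat) (u : 'rV[R]_p) : 0 <= dot u u.
Proof. by apply: sumr_ge0 => j _; rewrite -expr2 sqr_ge0. Qed.

Lemma norm2_ge0 (R : realType) (p : nat) (u : 'rV[R]_p) : 0 <= norm2 u.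
Proof. exact: sqrtr_ge0. Qed.

Lemma norm2Z (R : realType) (p : nat) (a : R) (u : 'rV[R]_p) :
  norm2 (a *: u) = `|a| * norm2 u.
Proof.
by rewrite /norm2 dotZl dotZr mulrA -expr2 sqrtrM ?sqr_ge0// sqrtr_sqr.
Qed.

Lemma norm2B (R : realType) (p : nat) (u v : 'rV[R]_p) :
  norm2 (u - v) = norm2 (v - u).
Proof. by rewrite -opprB -scaleN1r norm2Z normrN normr1 mul1r. Qed.

Lemma dotvv (R : realType) (p : nat) (u : 'rV[R]_p) : dot u u = norm2 u ^+ 2.
Proof. by rewrite sqr_sqrtr ?dot_ge0. Qed.

Lemma coord_le_norm2 (R : realType) (p : nat) (u : 'rV[R]_p) (j : 'I_p) :
  `|u ord0 j| <= norm2 u.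
Proof.
rewrite -sqrtr_sqr ler_wsqrtr// expr2 /dot (bigD1 j)//= lerDl.
by apply: sumr_ge0 => k _; rewrite -expr2 sqr_ge0.
Qed.

(** Links the Euclidean norm of the problem with the sup norm that defines the
    topology of row vectors: Euclidean-bounded sets are bounded, and Euclidean
    balls lie in sup-norm balls of the same radius. *)
Lemma mx_norm_le_norm2 (R : realType) (p : nat) (u : 'rV[R]_p) :
  `|u| <= norm2 u.
Proof.
rewrite [leLHS]/Num.norm /= mx_normrE; apply/bigmax_leP; split => [|[i j] _ /=].
  exact: norm2_ge0.
by rewrite ord1 coord_le_norm2.
Qed.

Lemma norm2_eq0 (R : realType) (p : nat) (u : 'rV[R]_p) :
  norm2 u = 0 -> u = 0.
Proof.
move=> u0; apply/eqP; rewrite -normr_le0.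
by rewrite -u0 mx_norm_le_norm2.
Qed.

Lemma continuous_dot (T : topologicalType) (R : realType) (p : nat)
    (f g : T -> 'rV[R]_p) :
  continuous f -> continuous g -> continuous (fun x => dot (f x) (g x)).
Proof.
move=> cf cg; apply: (@continuous_big _ _ _ _ _ add_continuous) => j _ x.
have coord h : continuous h -> (h y : 'rV[R]_p) ord0 j @[y --> x] --> h x ord0 j.
  by move=> ch; exact: (@continuous_comp _ _ _ h (fun M => M ord0 j) x (ch x)
    (@coord_continuous _ _ _ ord0 j (h x))).
by apply: cvgM; exact: coord.
Qed.

Lemma norm2_continuous (R : realType) (p : nat) : continuous (@norm2 R p).
Proof.
move=> u; apply: (@continuous_comp _ _ _ (fun u => dot u u)).
  by apply: continuous_dot => v; exact: cvg_id.
exact: sqrt_continuous.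
Qed.

(** Only the points at most as long as a given point of F matter; they form
    a closed bounded set, hence a compact one. *)
Lemma closed_argmin_norm2 (R : realType) (p : nat) (F : set 'rV[R]_p) :
  F !=set0 -> closed F -> argmin F (@norm2 R p) !=set0.
Proof.
move=> [u0 Fu0] clF.
pose A := F `&` [set u | norm2 u <= norm2 u0].
have clA : closed A.
  apply: closedI => //; apply: (@preimage_closed _ _ (@norm2 R p) [set x | x <= _]).
    by move=> u _; exact: norm2_continuous.
  exact: closed_le.
have bA : bounded_set A.
  exists (norm2 u0); split; first exact: num_real.
  move=> M /ltW u0M u [_ /= uu0].
  by rewrite (le_trans (mx_norm_le_norm2 _ _ _))// (le_trans uu0).
have A0 : A !=set0 by exists u0; split => /=.
have [u /set_mem[Fu uu0] umin] := EVT_min_rV A0 (bounded_closed_compact bA clA)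
    (continuous_subspaceT (@norm2_continuous R p)).
exists u; split => // w Fw.
(* Points of F outside A are longer than u0, hence than the minimizer on A. *)
have [wu0|/ltW u0w] := leP (norm2 w) (norm2 u0).
  by apply: umin; rewrite inE.
exact: le_trans u0w.
Qed.

Section feasible_sets.
Context {R : realType} {S T : Type} (X : S -> set T) {p : nat}.
Context (phi : S -> T -> 'rV[R]_p) {N : nat}.
Context (shat : 'I_N -> S) (xhat : 'I_N -> T).

Let F := min_norm_feasible X phi shat xhat.

(** An intersection of preimages of closed half-lines under the linear forms
    [dot _ v], one for each constraint vector v. *)
Lemma min_norm_feasible_closed : closed F.
Proof.
rewrite (_ : F = \bigcap_(ix in [set ix : 'I_N * T | X (shat ix.1) ix.2])
    ((fun u => dot u (phi (shat ix.1) (xhat ix.1) - phi (shat ix.1) ix.2)) @^-1`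
     [set a | a <= - norm2 (phi (shat ix.1) ix.2 -
                            phi (shat ix.1) (xhat ix.1))])).
  apply: closed_bigI => ix _; apply: preimage_closed; last exact: closed_le.
  move=> u _; apply: (@continuous_dot _ _ _ id (fun=> _)) => w.
    exact: cvg_id.
  exact: cst_continuous.
apply/seteqP; split => [u Fu [i x] /= Xx|u Fu i x Xx].
  by rewrite -subr_le0 opprK; exact: Fu.
by move: (Fu (i, x) Xx); rewrite /= -subr_le0 opprK.
Qed.

(** Let the e-ball around u lie in the cone and t < e.  For a constraint
    vector v, the point u + t v / |v| is in the cone, and its product with v is
    dot u v + t |v|.  Hence u / t is feasible. *)
Lemma min_norm_feasible_nonempty :
  interior (consistent_cone X phi shat xhat) !=set0 -> F !=set0.
Proof.
move=> [u /nbhs_ballP[e /= e0 eC]].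
pose t := e / 2; have t0 : 0 < t by rewrite divr_gt0.
exists (t^-1 *: u) => i x Xx; rewrite norm2B dotZl.
set v := _ - _.
(* For v = 0 the convention 0^-1 = 0 makes the displaced point u itself. *)
have /eC /(_ i x Xx) : ball u e (u + (t / norm2 v) *: v).
  rewrite mx_norm_ball /ball_ /= opprD addNKr normrN normrZ.
  rewrite normf_div [`|t|]gtr0_norm// [`|norm2 _|]ger0_norm ?norm2_ge0//.
  apply: (@le_lt_trans _ _ t); last by rewrite gtr_pMr// invf_lt1 ?ltr1n.
  have [->|v0] := eqVneq (norm2 v) 0; first by rewrite invr0 mulr0 mul0r ltW.
  rewrite -mulrA ler_piMr ?(ltW t0)// mulrC ler_pdivrMr.
    by rewrite mul1r mx_norm_le_norm2.
  by rewrite lt0r v0 norm2_ge0.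
rewrite -/v dotDl dotZl dotvv.
have -> : t / norm2 v * norm2 v ^+ 2 = t * norm2 v.
  by have [->|v0] := eqVneq (norm2 v) 0; rewrite ?expr0n/= ?mulr0// expr2 mulrA divfK.
by rewrite -(@pmulr_rle0 _ t^-1) ?invr_gt0// mulrDr mulKf ?gt_eqF.
Qed.

(** The change of variables theta |-> theta / r between the two problems, in
    the form that transports feasibility both ways. *)
Lemma incenter_feasibleE (u : 'rV[R]_p) (r : R) : 0 < r ->
  incenter_feasible X phi shat xhat (u, r) <-> F (r^-1 *: u) /\ norm2 u = 1.
Proof.
move=> r0; have E i x : dot (r^-1 *: u) (phi (shat i) (xhat i) - phi (shat i) x)
     + norm2 (phi (shat i) x - phi (shat i) (xhat i)) <= 0 <->
    dot u (phi (shat i) (xhat i) - phi (shat i) x)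
     + r * norm2 (phi (shat i) x - phi (shat i) (xhat i)) <= 0.
  by rewrite dotZl -(@pmulr_rle0 _ r _ r0) mulrDr mulVKf ?gt_eqF.
by split => -[h u1]; split => // i x Xx; apply/E; exact: h.
Qed.

(** At u = 0 the constraints force all feature differences to vanish. *)
Lemma min_norm_feasible_norm2_gt0 (u : 'rV[R]_p) :
  feature_separating X phi shat xhat -> F u -> 0 < norm2 u.
Proof.
move=> [i [x [Xx sep]]] Fu; rewrite lt0r norm2_ge0 andbT.
apply/eqP => /norm2_eq0 u0; apply: sep.
apply/eqP; rewrite -subr_eq0; apply/eqP/norm2_eq0/eqP.
rewrite eq_le norm2_ge0 andbT.
by have := Fu i x Xx; rewrite u0 -(scale0r 0) dotZl mul0r add0r.
Qed.

End feasible_sets.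

Theorem corollary3p6 (R : realType) (S T : Type) (X : S -> set T)
    (p : nat) (phi : S -> T -> 'rV[R]_p)
    (N : nat) (shat : 'I_N -> S) (xhat : 'I_N -> T)
    (hxhat : forall i : 'I_N, X (shat i) (xhat i))
    (hphi : feature_not_trivially_zero X phi shat)
    (hsep : feature_separating X phi shat xhat)
    (hint : interior (consistent_cone X phi shat xhat) !=set0) :
  (min_norm_solution X phi shat xhat !=set0) /\
  (forall thetabar : 'rV[R]_p, min_norm_solution X phi shat xhat thetabar ->
     exists r : R,
       incenter_solution X phi shat xhat ((norm2 thetabar)^-1 *: thetabar, r)).
Proof.
split.
  apply: closed_argmin_norm2; last exact: min_norm_feasible_closed.
  exact: min_norm_feasible_nonempty.
move=> u [Fu umin]; exists (norm2 u)^-1.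
have u0 : 0 < norm2 u by exact: min_norm_feasible_norm2_gt0 Fu.
split.
  apply/incenter_feasibleE; first by rewrite invr_gt0.
  rewrite invrK scalerA divff ?gt_eqF// scale1r; split => //.
  by rewrite norm2Z ger0_norm ?invr_ge0 ?ltW// mulVf ?gt_eqF.
(* A competitor with r > 0 gives the feasible vector w / r, of norm 1 / r. *)
move=> [w r] wr /=; have [r0|r0] := leP r 0.
  by rewrite (le_trans r0)// invr_ge0 ltW.
have [Fw w1] := (incenter_feasibleE _ _ _ _ _ _ r0).1 wr.
have := umin _ Fw.
rewrite norm2Z w1 mulr1 gtr0_norm ?invr_gt0// => ur.
by rewrite -[r]invrK lef_pV2 ?posrE ?invr_gt0.
Qed.
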